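(* For a sequence $(p_i)_{i\in\mathbf{N}}$ of prime numbers, let $\mathcal{A}(p)$ denote the British number system generated by $(p_i)_{i\in\mathbf{N}}$. The map $(p_i)_{i\in\mathbf{N}} \mapsto \mathcal{A}(p)$ is a one-to-one correspondence between the set of all infinite sequences of prime numbers and the set of all indecomposable British number systems. Moreover, every additive system is either indecomposable or a contraction of an indecomposable additive system.
   Context: $\mathbf{N}=\{1,2,3,\ldots\}$ and $\mathbf{N}_0=\{0,1,2,\ldots\}$. For integers $a<b$, $[a,b)=\{x\in\mathbf{Z}: a\le x<b\}$. For an integer $g$ and a set $X$ of integers, $g\ast X=\{gx:x\in X\}$. Additive system: a family $\mathcal{A}=(A_i)_{i\in I}$, indexed by a nonempty finite or infinite set $I$, of sets of nonnegative integers with $0\in A_i$ and $|A_i|\ge 2$ for all $i\in I$ (each $A_i$ may be finite or infinite), such that every $n\in\mathbf{N}_0$ has a unique representation $n=\sum_{i\in I}a_i$ with $a_i\in A_i$ for all $i$ and $a_i\neq 0$ for only finitely many $i$. British number system generated by a sequence of integers $(g_i)_{i\in\mathbf{N}}$ with $g_i\ge 2$ for all $i$: put $G_0=1$ and $G_i=\prod_{j=1}^i g_j$; it is the additive system $(A_i)_{i\in\mathbf{N}}$ with $A_i=G_{i-1}\ast[0,g_i)$. (It is known that this is an additive system, and, by a theorem of de Bruijn, that every additive system is a British number system or a contraction of one.) Contraction: if $\mathcal{B}=(B_j)_{j\in J}$ is an additive system and $(J_i)_{i\in I}$ is a partition of $J$ into pairwise disjoint nonempty sets, then the additive system $(A_i)_{i\in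 I}$ with $A_i=\sum_{j\in J_i}B_j$ (the set of all sums $\sum_{j\in J_i}b_j$ with $b_j\in B_j$ and only finitely many $b_j$ nonzero) is called a contraction of $\mathcal{B}$. A set $A$ of integers is decomposable if there are sets of integers $B,C$ with $|B|\ge 2$, $|C|\ge2$, $A=\{b+c:b\in B,c\in C\}$, and every element of $A$ has exactly one representation as $b+c$ with $b\in B$, $c\in C$; otherwise $A$ is indecomposable. An additive system $(A_i)_{i\in I}$ is indecomposable if every $A_i$ is an indecomposable set. *)

(* Defs.v *)
From mathcomp Require Import all_boot all_order all_algebra.
From mathcomp Require Import all_classical.

Set Implicit Arguments.
Unset Strict Implicit.
Unset Printing Implicit Defensive.

Import Order.TTheory GRing.Theory Num.Theory.

Local Open Scope classical_set_scope.
Local Open Scope ring_scope.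
Local Open Scope card_scope.

(** The finiteness condition is essential: [\sum_(i \in D) a i] is [0] by
    convention when infinitely many [a i] with [i \in D] are nonzero. *)
Definition represents (I : choiceType) (D : set I) (A : I -> set int)
    (a : I -> int) (n : int) : Prop :=
  [/\ forall i, D i -> A i (a i),
      finite_set [set i | D i /\ a i <> 0] &
      n = \sum_(i \in D) a i].

Definition sumset (I : choiceType) (D : set I) (A : I -> set int) : set int :=
  [set n | exists a : I -> int, represents D A a n].

Definition additive_system (I : choiceType) (A : I -> set int) : Prop :=
  [/\ [set: I] !=set0,
      forall i, [/\ A i `<=` [set x | 0 <= x], A i 0 & `I_2 #<= A i] &
      forall n : nat, exists! a : I -> int, represents [set: I] A a n%:Z].

(** [A] is the contraction of [B] along the partition [P] of [J]. *)
Definition contraction (I J : choiceType) (A : I -> set int)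
    (B : J -> set int) : Prop :=
  additive_system B /\
  exists P : I -> set J,
    partition [set: I] P [set: J] /\ forall i, A i = sumset (P i) B.

Definition decomposable (A : set int) : Prop :=
  exists B C : set int,
    [/\ `I_2 #<= B, `I_2 #<= C,
        A = [set b + c | b in B & c in C] &
        forall a, A a ->
          exists! bc : int * int, [/\ B bc.1, C bc.2 & a = bc.1 + bc.2]].

Definition indecomposable_system (I : choiceType) (A : I -> set int) : Prop :=
  additive_system A /\ forall i, ~ decomposable (A i).

(** Indices start at 0: [g i] is the generator usually written g_(i+1), and
    [british g i] is the set usually written A_(i+1) = G_i * [0, g_(i+1)). *)
Definition british_base (g : nat -> nat) (i : nat) : nat :=
  (\prod_(j < i) g j)%N.

Definition british (g : nat -> nat) (i : nat) : set int :=
  [set (british_base g i)%:Z * x | x in [set x : int | 0 <= x < (g i)%:Z]].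

Definition british_number_system (A : nat -> set int) : Prop :=
  exists g : nat -> nat, (forall i, (2 <= g i)%N) /\ A = british g.

(* Main.v *)
Require Import Defs.
From mathcomp Require Import all_boot all_order all_algebra.
From mathcomp Require Import all_classical.
From mathcomp Require Import finmap zify.

Set Implicit Arguments.
Unset Strict Implicit.
Unset Printing Implicit Defensive.

Import Order.TTheory GRing.Theory Num.Theory.

Local Open Scope classical_set_scope.
Local Open Scope ring_scope.

(** A decomposition of a set with [p] elements factors [p], and conversely
    [0, u v) = [0, u) + u * [0, v); so [british g i] is indecomposable iff
    [g i] is prime, and its cardinality recovers [g i].

    For the second part, every additive system [A] is a contraction of some
    [british p] with [p] prime-valued (de Bruijn).  Let [A i] be the set
    containing 1 and [C] the sums of the other sets, so that [A i] and [C]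
    are complements in the natural numbers.  If [g] is the least positive
    element of [C], then [C] consists of multiples of [g] and [A i] is a union
    of blocks [g q + [0, g)].  For a prime [p] dividing [g], dividing by [p]
    the multiples of [p] in each set gives again a system of the same kind.
    Iterating produces primes [p_k] and indices [i_k] such that [A j] is the
    set of integers whose [p]-adic (mixed radix) digits vanish at all [k] with
    [i_k <> j]. *)

(** * Complementing pairs of sets of natural numbers *)

Section ComplementingPairs.
Local Open Scope nat_scope.
Variables (A C : set nat).
Hypotheses (A0 : A 0) (C0 : C 0) (A1 : A 1).
Hypothesis AC_total : forall n, exists a c, [/\ A a, C c & n = a + c].
Hypothesis AC_inj : forall a c a' c', A a -> C c -> A a' -> C c' ->
  a + c = a' + c' -> a = a' /\ c = c'.

(** Strong induction on [m]: the representation [g * m = a + c] propagates to the whole block as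
    [g * m + s = (a + s) + c] for [s < g], and uniqueness then decides which elements of the block
    lie in [A] or [C]. *)
Lemma complementing_blocks g : C g -> 0 < g -> (forall c, C c -> 0 < c -> g <= c) ->
  forall m r, r < g -> (C (g * m + r) -> r = 0) /\ (A (g * m + r) <-> A (g * m)).
Proof.
move=> Cg g0 gmin.
have Alow r : r < g -> A r.
  move=> rg; have [a [c [Aa Cc rE]]] := AC_total r.
  have [c0|c0] := posnP c; first by rewrite rE c0 addn0.
  by have := gmin _ Cc c0; lia.
have g2 : 1 < g.
  rewrite ltn_neqAle g0 andbT; apply/eqP => g1.
  by have [] := AC_inj A1 C0 A0 Cg; lia.
elim/ltn_ind => m IH r rg.
have [m0|m0] := posnP m.
  rewrite m0 muln0 add0n; split; last by split=> _ //; exact: Alow.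
  by move=> Cr; have [//|r0] := posnP r; have := gmin _ Cr r0; lia.
have IHC c : C c -> c < g * m -> exists2 k, c = g * k & k < m.
  move=> Cc cm; have ck : c %/ g < m by rewrite ltn_divLR // mulnC.
  have [+ _] := IH _ ck (c %% g) (ltn_pmod _ g0).
  by rewrite mulnC -divn_eq => /(_ Cc) c0; exists (c %/ g) => //; rewrite {1}(divn_eq c g) c0; lia.
have IHA q s : q < m -> s < g -> A (g * q + s) <-> A (g * q).
  by move=> qm sg; have [_] := IH _ qm _ sg.
have [a [c [Aa Cc mE]]] := AC_total (g * m).
have [cE|/eqP cNm] := eqVneq c (g * m).
  (* The block [g m + [0, g)] is covered by [[0, g) + {g m}]. *)
  have repr s : s < g -> forall x y, A x -> C y -> x + y = g * m + s -> x = s /\ y = g * m.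
    move=> sg x y Ax Cy xyE; apply: AC_inj => //; first exact: Alow.
      by rewrite -cE.
    by lia.
  have noA s : s < g -> ~ A (g * m + s).
    move=> sg As; have [] := repr s sg _ _ As C0; first by rewrite addn0.
    by nia.
  split; last by split=> [/noA|] //; rewrite -[g * m]addn0 => /noA; case.
  by move=> Cr; have [] := repr r rg _ _ A0 Cr => //; lia.
have [c0|c0] := posnP c.
  have Am : A (g * m) by rewrite mE c0 addn0.
  (* An element [g * m + s] of [C] with [s > 0] would give [g * m + g] the second representation
     [(g - s) + (g * m + s)]. *)
  have noC s : s < g -> ~ C (g * m + s).
    move=> sg Cs; have [s0|s0] := posnP s.
      by have [] := AC_inj Am C0 A0 Cs; nia.
    have [||] := AC_inj Am Cg (Alow (g - s) _) Cs; nia.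
  split=> [/noC|]; first by case.
  (* If [c' = g * k] with [k > 0], then [g * (m - k)] lies in [A] by induction, and [g * m] gets two
     representations. *)
  split=> // _; have [a' [c' [Aa' Cc' E]]] := AC_total (g * m + r).
  have [c'm|c'm] := leqP (g * m) c'.
    by have [] := noC (c' - g * m); [lia|rewrite subnKC].
  have [k c'E km] := IHC _ Cc' c'm.
  have [k0|k0] := posnP k; first by rewrite E c'E k0 muln0 addn0.
  have a'E : a' = g * (m - k) + r by rewrite mulnBr; nia.
  have Ak : A (g * (m - k)) by apply/(IHA _ r) => //; [lia|rewrite -a'E].
  by have [] := AC_inj Am C0 Ak Cc'; [rewrite mulnBr; nia|nia].
(* Remaining case [0 < c < g * m]: the block is a full block of [A] shifted by [c], so it meets
   neither [A] nor [C]. *)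
have cm : c < g * m by lia.
have [k cE km] := IHC _ Cc cm.
have aE : a = g * (m - k) by rewrite mulnBr; nia.
have Ar s : s < g -> A (a + s).
  by move=> sg; rewrite aE; apply/IHA => //; [nia|rewrite -aE].
have repr s : s < g -> forall x y, A x -> C y -> x + y = g * m + s -> x = a + s /\ y = c.
  by move=> sg x y Ax Cy xyE; apply: AC_inj => //; [exact: Ar|lia].
have noA s : s < g -> ~ A (g * m + s).
  by move=> sg As; have [] := repr s sg _ _ As C0; lia.
split; last by split=> [/noA|] //; rewrite -[g * m]addn0 => /noA; case.
by move=> Cr; have [] := repr r rg _ _ A0 Cr; lia.
Qed.

(** Any prime divisor of the least positive element [g] of [C] works, since blocks of length [p]
    refine those of length [g]. If [C] contains only [0], then [A] is everything and any prime
    serves. *)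
Lemma complementing_prime : exists p, [/\ prime p,
  forall c, C c -> p %| c & forall n, A n <-> A (p * (n %/ p))].
Proof.
have [[g0 [Cg0 g0_gt0]]|noC] := pselect (exists g, C g /\ 0 < g); last first.
  have AN n : A n.
    have [a [c [Aa Cc ->]]] := AC_total n.
    by have [->|c0] := posnP c; [rewrite addn0|case: noC; exists c].
  exists 2; split=> // c Cc; have [->//|c0] := posnP c.
  by case: noC; exists c.
have [g /asboolP[Cg g_gt0] gmin] :=
  ex_minnP (ex_intro (fun g => `[< C g /\ 0 < g >]) g0 (asboolT (conj Cg0 g0_gt0))).
have blk := complementing_blocks Cg g_gt0
  (fun c Cc c0 => gmin c (asboolT (conj Cc c0))).
have g2 : 1 < g.
  rewrite ltn_neqAle g_gt0 andbT; apply/eqP => g1.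
  by have [] := AC_inj A1 C0 A0 Cg; lia.
have [p p_pr /dvdnP[h gE]] := pdivP g2.
have gA n : A n <-> A (g * (n %/ g)).
  have [_] := blk (n %/ g) (n %% g) (ltn_pmod _ g_gt0).
  by rewrite {1}[g * _]mulnC -divn_eq.
exists p; split=> // [c Cc|n].
  have [+ _] := blk (c %/ g) (c %% g) (ltn_pmod _ g_gt0).
  rewrite mulnC -divn_eq => /(_ Cc) c0; apply: (@dvdn_trans g); last exact/eqP.
  by rewrite gE dvdn_mull.
rewrite gA (gA (p * _)); suff -> : p * (n %/ p) %/ g = n %/ g by [].
by rewrite gE [h * p]mulnC !divnMA mulKn ?prime_gt0.
Qed.

End ComplementingPairs.

(** * Representations and descent *)

Lemma represents_update (I : choiceType) (A : I -> set int) a n i x :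
  represents [set: I] A a n -> A i x ->
  represents [set: I] A [eta a with i |-> x] (n - a i + x).
Proof.
(* [F] contains [i] even when [a i = 0], so the sums before and after the update both run over [F]
   and differ only at [i]. *)
move=> [Aa fa nE] Ax; pose F := i |` [set i | setT i /\ a i <> 0].
have Ffin : finite_set F by rewrite finite_setU; split=> //; exact: finite_set1.
split=> [j _|| /=].
- by rewrite /=; case: eqVneq => [->//|_]; exact: Aa.
- apply: sub_finite_set Ffin => j [_ /=]; case: eqVneq => [->|_ aj]; first by left.
  by right.
have sumF (b : I -> int) : (forall j, ~ F j -> b j = 0) ->
    \sum_(j \in [set: I]) b j = b i + \sum_(j \in F `\ i) b j.
  move=> b0; rewrite -(fsbigD1 i F) //; last by left.
  by apply/esym/fsbig_widen => // j [_ /b0].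
have aF j : ~ F j -> a j = 0.
  by move=> nFj; apply: contrapT => aj; apply: nFj; right.
rewrite (sumF _ _) => [|j nFj]; last first.
  by case: eqVneq => [ji|_]; [case: nFj; left|exact: aF].
rewrite nE (sumF _ aF) eqxx.
under [in RHS]eq_fsbigr => j /set_mem[_ /eqP/negPf ->] do over.
by rewrite [a i + _]addrC addrK addrC.
Qed.

Lemma represents_scale (I : choiceType) (A : I -> set int) (d : int) b n : d != 0 ->
  represents [set: I] (fun i => [set x | A i (d * x)]) b n <->
  represents [set: I] A (fun i => d * b i) (d * n).
Proof.
move=> d0; have supp : [set i | setT i /\ d * b i <> 0] = [set i | setT i /\ b i <> 0].
  apply/seteqP; split=> i [_ bi]; split=> //.
    by move=> b0; apply: bi; rewrite b0 mulr0.
  by move/eqP; rewrite mulf_eq0 (negPf d0) => /eqP.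
split=> -[Ab fb E]; split=> //.
- by rewrite supp.
- by rewrite E mulr_fsumr.
- by rewrite -supp.
- by apply: (mulfI d0); rewrite E mulr_fsumr.
Qed.

(** Padding by zeros makes uniqueness in the whole system available for sums over [D]. *)
Lemma represents_restrict (I : choiceType) (D : set I) (A : I -> set int) a n :
  (forall i, A i 0) -> represents D A a n ->
  represents [set: I] A (patch (fun=> 0) D a) n.
Proof.
move=> A0 [Aa fa ->]; split=> [i _||]; last by rewrite fsbig_mkcond.
- by rewrite /patch; case: ifPn => // /set_mem; exact: Aa.
- by apply: sub_finite_set fa => i [_]; rewrite /patch; case: ifPn => // /set_mem.
Qed.

Lemma represents_support (I : choiceType) (D : set I) (A : I -> set int) a n :
  (forall i, ~ D i -> a i = 0) -> represents [set: I] A a n -> represents D A a n.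
Proof.
move=> aD [Aa fa ->]; split=> [i _||]; first exact: Aa.
  by apply: sub_finite_set fa => i [].
by apply/esym/fsbig_widen => // i [_ /aD].
Qed.

Lemma represents0 (I : choiceType) (A : I -> set int) :
  (forall i, A i 0) -> represents [set: I] A (fun=> 0) 0.
Proof.
move=> A0; split=> //; last by rewrite fsbig1.
by rewrite (_ : [set _ | _] = set0) ?finite_set0 //; apply/seteqP; split=> i // -[].
Qed.

(* Unlike in an additive system, the sets may be reduced to [{0}], which makes
   the notion stable under [descent_step]. *)
Definition weak_system (I : choiceType) (A : I -> set int) : Prop :=
  [/\ forall i, A i `<=` [set x | 0 <= x], forall i, A i 0 &
      forall n : nat, exists! a : I -> int, represents [set: I] A a n%:Z].

Lemma additive_weak (I : choiceType) (A : I -> set int) :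
  additive_system A -> weak_system A.
Proof. by move=> [_ Ai repA]; split=> // i; have [] := Ai i. Qed.

Section WeakSystem.
Variables (I : choiceType) (A : I -> set int).
Hypothesis wA : weak_system A.

Lemma weak_system_uniq (n : nat) a b :
  represents [set: I] A a n%:Z -> represents [set: I] A b n%:Z -> a = b.
Proof.
by have [_ _ /(_ n)[c [_ cP]]] := wA; move=> /cP <- /cP <-.
Qed.

(** Replacing [a i] by [0] leaves a representation of [n - a i], which is a sum of nonnegative
    terms. *)
Lemma represents_le a n i : represents [set: I] A a n -> 0 <= a i <= n.
Proof.
have [Apos A0 _] := wA; move=> ra; have [Aa _ _] := ra.
have ge0 b m : represents [set: I] A b m -> 0 <= m.
  by move=> [Ab _ ->]; apply: fsumr_ge0 => j _; apply/Apos/Ab.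
have := ge0 _ _ (represents_update ra (A0 i)); rewrite addr0 subr_ge0 => ->.
by rewrite andbT; apply/Apos/Aa.
Qed.

Lemma weak_system_one : exists i, A i 1.
Proof.
have [_ _ /(_ 1%N)[a [ra _]]] := wA; have [Aa _ sumE] := ra.
have [[i ai]|na] := pselect (exists i, a i <> 0).
  exists i; suff <- : a i = 1 by exact: Aa.
  by have := represents_le i ra; lia.
suff : \sum_(i \in [set: I]) a i = 0 by rewrite -sumE.
by apply: fsbig1 => i _; apply: contrapT => ai; apply: na; exists i.
Qed.

(** Here [i] is the index whose set contains [1]. The equivalence says that the last base-[p] digit
    is free in [A i] and zero in every other set. *)
Lemma descent_step : exists i p, [/\ prime p,
  weak_system (fun j => [set x | A j (p%:Z * x)]) &
  forall j (n : nat),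
    A j n%:Z <-> (j <> i -> (p %| n)%N) /\ A j (p * (n %/ p))%N%:Z].
Proof.
have [Apos A0 repA] := wA; have [i A1] := weak_system_one.
pose Ai := [set n : nat | A i n%:Z].
(* Sums of the sets other than [A i], encoded as full representations so that [represents_update]
   can set or clear the coordinate at [i]. *)
pose C := [set n : nat | exists2 a, represents [set: I] A a n%:Z & a i = 0].
have CP a n : represents [set: I] A a n%:Z -> C (n - `|a i|)%N.
  move=> ra; have := represents_update ra (A0 i); have := represents_le i ra.
  move=> /andP[ai0 ain] ra'; exists [eta a with i |-> 0]; last by rewrite /= eqxx.
  by rewrite -subzn ?gez0_abs // -1?[X in represents _ _ _ X]addr0 //; lia.
have A_C j (n : nat) : j <> i -> A j n%:Z -> C n.
  move=> /eqP ji Ajn; exists [eta (fun=> 0) with j |-> n%:Z].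
    by have := represents_update (represents0 A0) Ajn; rewrite subr0 add0r.
  by rewrite /= eq_sym (negPf ji).
have C0 : C 0%N by exists (fun=> 0); first exact: represents0.
have AC_total (n : nat) : exists a c, [/\ Ai a, C c & n = (a + c)%N].
  have [a [ra _]] := repA n; have [Aa _ _] := ra; have := represents_le i ra.
  move=> /andP[ai0 ain]; exists `|a i|%N, (n - `|a i|)%N; split; last by lia.
    by rewrite /Ai /= gez0_abs //; exact: Aa.
  exact: CP.
have AC_inj a c a' c' : Ai a -> C c -> Ai a' -> C c' ->
    (a + c = a' + c')%N -> a = a' /\ c = c'.
  move=> Aa [f rf fi] Aa' [f' rf' fi'] E.
  have := represents_update rf Aa; have := represents_update rf' Aa'.
  rewrite fi fi' !subr0 -!PoszD ![(_ + a)%N]addnC ![(_ + a')%N]addnC E => r' r.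
  have /(congr1 (fun h => h i)) := weak_system_uniq r r'.
  by rewrite /= eqxx => -[aa']; split=> //; lia.
have [p [p_pr pC pA]] := complementing_prime (A0 i) C0 A1 AC_total AC_inj.
have p0 : (0 < p)%N := prime_gt0 p_pr.
have pz0 : p%:Z != 0 by lia.
have dvdA j (n : nat) : j <> i -> A j n%:Z -> (p %| n)%N.
  by move=> ji /(A_C _ _ ji); exact: pC.
exists i, p; split=> //.
- split=> [j x /Apos /=|j|n] /=.
  + by rewrite pmulr_rge0 //; lia.
  + by rewrite mulr0.
  have [a [ra _]] := repA (p * n)%N; have [Aa _ _] := ra.
  (* All coordinates of [p * n] are multiples of [p]: those off [i] lie in [C], and [a i] is [p * n]
     minus an element of [C]. *)
  have dvda j : (p %| `|a j|)%N.
    have /andP[aj0 ajn] := represents_le j ra.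
    have [->|/eqP ji] := eqVneq j i; last first.
      by apply: (dvdA j) => //; rewrite gez0_abs //; exact: Aa.
    have ain : (`|a i| <= p * n)%N by have := represents_le i ra; lia.
    by have := pC _ (CP _ _ ra); rewrite dvdn_subr // dvdn_mulr.
  have aE : a = (fun j => p%:Z * (`|a j| %/ p)%N%:Z).
    apply/funext => j; rewrite -PoszM mulnC divnK // gez0_abs //.
    by have /andP[] := represents_le j ra.
  exists (fun j => (`|a j| %/ p)%N%:Z); split.
    by apply/represents_scale => //; rewrite -aE -PoszM.
  move=> b /(represents_scale _ _ _ pz0); rewrite -PoszM => rb.
  rewrite (weak_system_uniq ra rb); apply/funext => j.
  have /andP[+ _] := represents_le j rb.
  by rewrite pmulr_rge0 ?ltz_nat // abszM mulKn // => /gez0_abs.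
- move=> j n; have [->|/eqP ji] := eqVneq j i.
    by split=> [/pA Ap|[_ Ap]]; [split|exact/pA].
  split=> [Aj|[/(_ ji) pn]]; last by rewrite mulnC divnK.
  by have pn := dvdA _ _ ji Aj; split=> //; rewrite mulnC divnK.
Qed.

End WeakSystem.

(** * Mixed radix digits *)

Local Open Scope card_scope.

Definition digit (g : nat -> nat) (n k : nat) : nat :=
  ((n %/ british_base g k) %% g k)%N.

Lemma british_baseS g k : british_base g k.+1 = (british_base g k * g k)%N.
Proof. by rewrite /british_base big_ord_recr. Qed.

Lemma britishP g i x :
  british g i x <-> exists2 r, (r < g i)%N & x = (british_base g i * r)%N%:Z.
Proof.
split=> [[y /= /andP[y0 yg] <-]|[r rg ->]].
  by exists `|y|%N; [lia|rewrite PoszM gez0_abs].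
by exists r%:Z; [rewrite /=; lia|rewrite PoszM].
Qed.

Lemma card_ge2 (T : Type) (A : set T) x y : A x -> A y -> x <> y -> `I_2 #<= A.
Proof.
move=> Ax Ay xy; pose f (n : nat) := if n == 0%N then x else y.
have finj : {in `I_2 &, injective f}.
  by move=> [|[|m]] [|[|n]] /set_mem /= ? /set_mem /= ? // /esym.
rewrite -(card_le_eql (inj_card_eq finj)); apply: subset_card_le.
by move=> _ [[|n] _ <-].
Qed.

Lemma card_ge2_neq (T : Type) (A : set T) x : `I_2 #<= A -> exists2 y, A y & y <> x.
Proof.
move=> A2; apply: contrapT => nA.
have Ax : A `<=` (fun=> x) @` `I_1.
  by move=> y Ay; exists 0%N => //; apply: contrapT => yx; apply: nA; exists y => // /esym.
have := card_le_trans A2 (card_le_trans (subset_card_le Ax) (card_image_le _ _)).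
by rewrite card_le_II.
Qed.

Section British.
Variable g : nat -> nat.
Hypothesis g2 : forall i, (2 <= g i)%N.

Let G := british_base g.

(** A crude bound that lets [n] itself serve as a sufficient number of digits for [n]. *)
Lemma british_base_gt k : (k < G k)%N.
Proof.
elim: k => [|k IH]; first by rewrite /G /british_base big_ord0.
by rewrite /G british_baseS -/G; have := g2 k; nia.
Qed.

Lemma dvdn_british_base k m : (k <= m)%N -> (G k %| G m)%N.
Proof.
move=> /subnK <-; elim: (m - k)%N => [|d IH]; first exact: dvdnn.
by rewrite addSn {2}/G british_baseS dvdn_mulr.
Qed.

(** Each further digit refines the residue: [n %% G K.+1] is [n %% G K] plus [G K * digit g n K]. *)
Lemma sum_digits n K : (\sum_(k < K) G k * digit g n k = n %% G K)%N.
Proof.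
elim: K => [|K IH]; first by rewrite big_ord0 /G /british_base big_ord0 modn1.
rewrite big_ord_recr /= IH /digit -/G modn_divl /G british_baseS -/G [(g K * _)%N]mulnC.
by rewrite addnC mulnC [RHS](divn_eq _ (G K)) modn_dvdm // dvdn_mulr.
Qed.

Lemma sum_digits_lt (x : nat -> nat) K : (forall k, (x k < g k)%N) ->
  (\sum_(k < K) G k * x k < G K)%N.
Proof.
move=> xg; elim: K => [|K IH]; first by rewrite big_ord0 /G /british_base big_ord0.
rewrite big_ord_recr /= /G british_baseS -/G; apply: (@leq_trans (G K + G K * x K)).
  by rewrite ltn_add2r.
by rewrite -mulnS leq_mul2l xg orbT.
Qed.

Lemma digit_sum (x : nat -> nat) K k : (forall k, (x k < g k)%N) -> (k < K)%N ->
  digit g (\sum_(j < K) G j * x j)%N k = x k.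
Proof.
move=> xg; have Gk : (0 < G k)%N by apply: leq_ltn_trans (british_base_gt k).
elim: K => // K IH; rewrite ltnS leq_eqVlt big_ord_recr /digit -/G /= addnC.
case/orP=> [/eqP <-|kK].
  by rewrite mulnC divnMDl // divn_small ?sum_digits_lt // addn0 modn_small.
have /dvdnP[m ->] := dvdn_british_base kK.
rewrite {1}/G british_baseS -/G -(IH kK) /digit -/G.
have -> : (m * (G k * g k) * x K = (m * x K * g k) * G k)%N by nia.
by rewrite divnMDl // modnMDl.
Qed.

Lemma digit_eq0 n : (forall k, digit g n k = 0%N) -> n = 0%N.
Proof.
move=> d0; rewrite -(modn_small (british_base_gt n)) -sum_digits.
by rewrite big1 // => k _; rewrite d0 muln0.
Qed.

(** The coordinates are the weighted digits, so this equivalence contains both existence and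
    uniqueness of representations. *)
Lemma represents_british a (n : nat) : represents [set: nat] (british g) a n%:Z <->
  a = (fun k => (G k * digit g n k)%N%:Z).
Proof.
have sumI (b : nat -> int) K : (forall k, (K <= k)%N -> b k = 0) ->
    \sum_(k \in [set: nat]) b k = \sum_(k < K) b k.
  move=> b0; rewrite fsbig_ord; apply/esym/fsbig_widen => // k [_ /= kK].
  by apply: b0; rewrite leqNgt; exact/negP.
split=> [[ba fa nE]|->].
  have /choice[x xP] k : exists r, (r < g k)%N /\ a k = (G k * r)%N%:Z.
    by have /britishP[r] := ba k I; exists r.
  have xg k := (xP k).1; have ax k := (xP k).2.
  have [K aK] : exists K, forall k, (K <= k)%N -> a k = 0.
    have [s sE] := (finite_seqP _).1 fa; exists (\max_(j <- s) j).+1 => k sk.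
    apply: contrapT => ak; have : [set i | setT i /\ a i <> 0] k by [].
    rewrite sE /= => ks; suff : (k <= \max_(j <- s) j)%N by rewrite leqNgt sk.
    exact: leq_bigmax_seq.
  apply/funext => k; rewrite ax; congr (_ * _)%N%:Z.
  (* The cut-off [maxn K k.+1] keeps every nonzero term and also includes position [k]. *)
  rewrite -(digit_sum xg (leq_maxr K k.+1)); congr digit.
  apply/eqP; rewrite -eqz_nat nE (sumI _ (maxn K k.+1)) => [|j Kj]; last first.
    by apply: aK; apply: leq_trans Kj; exact: leq_maxl.
  by rewrite (big_morph _ PoszD (erefl _)); apply/eqP/eq_bigr.
have d0 k : (n <= k)%N -> digit g n k = 0%N.
  by move=> nk; rewrite /digit -/G divn_small ?mod0n // (leq_ltn_trans nk) ?british_base_gt.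
split=> [k _||].
- by apply/britishP; exists (digit g n k) => //; rewrite ltn_pmod //; apply: leq_trans (g2 k).
- apply: sub_finite_set (finite_II n) => k [_ /= dk]; rewrite ltnNge.
  by apply/negP => /d0 dk0; apply: dk; rewrite dk0 muln0.
- rewrite (sumI _ n) => [|k /d0 ->]; last by rewrite muln0.
  rewrite -[in LHS](modn_small (british_base_gt n)) -sum_digits.
  by rewrite (big_morph _ PoszD (erefl _)).
Qed.

Lemma british_additive : additive_system (british g).
Proof.
split=> [|i|n]; first by exists 0%N.
  have Gi : (0 < G i)%N by apply: leq_ltn_trans (british_base_gt i).
  have B0 : british g i 0 by apply/britishP; exists 0%N; [exact: ltnW|rewrite muln0].
  split=> // [_ /britishP[r _ ->] //|].
  apply: (card_ge2 B0 (y := (G i)%:Z)); last by lia.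
  by apply/britishP; exists 1%N => //; rewrite muln1.
exists (fun k => (G k * digit g n k)%N%:Z); split; first exact/represents_british.
by move=> a /represents_british ->.
Qed.

(** A sum over [D], padded by zeros, is the digit expansion; hence the sets of a contraction are cut
    out by vanishing digits. *)
Lemma sumset_british (D : set nat) (n : nat) :
  sumset D (british g) n%:Z <-> forall k, ~ D k -> digit g n k = 0%N.
Proof.
have [_ B0 _] := additive_weak british_additive.
have G0 k : (0 < G k)%N := leq_ltn_trans (leq0n k) (british_base_gt k).
split=> [[a /(represents_restrict B0) /represents_british aE] k Dk|dD].
  have := congr1 (fun f => f k) aE; rewrite /patch memNset // => -[/esym/eqP].
  by rewrite muln_eq0 eqn0Ngt G0 => /eqP.
exists (fun k => (G k * digit g n k)%N%:Z); apply: represents_support.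
  by move=> k /dD ->; rewrite muln0.
exact/represents_british.
Qed.

End British.

(** * Decompositions of British sets *)

Lemma card_uniq_seq (T : choiceType) (s : seq T) : uniq s -> [set` s] #= `I_(size s).
Proof.
move=> us; have -> : [set` s] = [set` [fset x in s]%fset].
  by apply/seteqP; split=> x /=; rewrite in_fset.
by apply/card_eq_fsetP; rewrite card_fseq undup_id.
Qed.

(** A translate of [B] and one of [C] lie in [A], so both are finite; addition is then a bijection
    from pairs onto [A]. *)
Lemma card_direct_sum (A B C : set int) n : B !=set0 -> C !=set0 -> A #= `I_n ->
  A = [set b + c | b in B & c in C] ->
  (forall a, A a ->
     exists! bc : int * int, [/\ B bc.1, C bc.2 & a = bc.1 + bc.2]) ->
  exists k l, [/\ B #= `I_k, C #= `I_l & n = (k * l)%N].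
Proof.
move=> [b0 Bb0] [c0 Cc0] An AE Auniq.
have Afin : finite_set A by apply/finite_setP; exists n.
have Bfin : finite_set B.
  apply: sub_finite_set (finite_image (fun a => a - c0) Afin) => b Bb.
  by exists (b + c0); [rewrite AE; exists b => //; exists c0|rewrite addrK].
have Cfin : finite_set C.
  apply: sub_finite_set (finite_image (fun a => a - b0) Afin) => c Cc.
  by exists (b0 + c); [rewrite AE; exists b0 => //; exists c|rewrite addrC addKr].
have addI : {in B `*` C &, injective (fun bc : int * int => bc.1 + bc.2)}.
  move=> [b c] [b' c'] /set_mem[/= Bb Cc] /set_mem[/= Bb' Cc'] E.
  have [|bc [_ bcP]] := Auniq (b + c); first by rewrite AE; exists b => //; exists c.
  by rewrite -(bcP (b, c)) // -(bcP (b', c')).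
have seqP (D : set int) : finite_set D -> exists2 s, uniq s & D = [set` s].
  move=> Dfin; exists (fset_set D); first exact: fset_uniq.
  by rewrite fset_setK.
have [sB uB BE] := seqP _ Bfin; have [sC uC CE] := seqP _ Cfin.
exists (size sB), (size sC); rewrite {1}BE {1}CE.
split; [exact: card_uniq_seq|exact: card_uniq_seq|apply/card_eq_II].
rewrite -(card_eql An) -(size_allpairs (fun b c : int => b + c)).
suff -> : A = [set` [seq b + c | b <- sB, c <- sC]].
  apply/card_uniq_seq/allpairs_uniq => //.
  move=> [b c] [b' c'] /allpairsP[[x y] [/= xB yC [-> ->]]].
  move=> /allpairsP[[x' y'] [/= xB' yC' [-> ->]]] E.
  apply: (addI (x, y) (x', y') _ _ E); apply/mem_set.
    by split=> /=; rewrite ?BE ?CE.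
  by split=> /=; rewrite ?BE ?CE.
rewrite AE; apply/seteqP; split=> [_ [b Bb [c Cc <-]]|_ /allpairsP[[b c] [/= bB cC ->]]].
  by apply: allpairs_f; [rewrite BE in Bb|rewrite CE in Cc].
by exists b; [rewrite BE|exists c; rewrite ?CE].
Qed.

Lemma card_british g i : (forall i, (2 <= g i)%N) -> british g i #= `I_(g i).
Proof.
move=> g2; have G0 := leq_ltn_trans (leq0n i) (british_base_gt g2 i).
have -> : british g i = (fun r => (british_base g i * r)%N%:Z) @` `I_(g i).
  apply/seteqP; split=> [x /britishP[r rg ->]|_ [r rg <-]]; first by exists r.
  by apply/britishP; exists r.
apply: inj_card_eq => r s _ _ [/eqP]; rewrite eqn_pmul2l // => /eqP //.
Qed.

Lemma british_indecomposable p i : (forall i, prime (p i)) -> ~ decomposable (british p i).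
Proof.
move=> p_pr [B [C [B2 C2 AE Auniq]]].
have p2 j := prime_gt1 (p_pr j).
have nonempty (D : set int) : `I_2 #<= D -> D !=set0.
  by move=> /(card_ge2_neq 0)[d]; exists d.
have [k [l [Bk Cl pE]]] :=
  card_direct_sum (nonempty _ B2) (nonempty _ C2) (card_british i p2) AE Auniq.
move: B2 C2; rewrite (card_le_eqr Bk) (card_le_eqr Cl) !card_le_II => k2 l2.
have /primeP[_ /(_ k)] := p_pr i; rewrite pE dvdn_mulr // => /(_ isT).
by case/orP=> /eqP; nia.
Qed.

Lemma british_decomposable g i u v : (forall i, (2 <= g i)%N) ->
  (2 <= u)%N -> (2 <= v)%N -> g i = (u * v)%N -> decomposable (british g i).
Proof.
move=> g2 u2 v2 gE; set G := british_base g i.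
have G0 : (0 < G)%N := leq_ltn_trans (leq0n i) (british_base_gt g2 i).
have divu r : (r < g i)%N -> (r %/ u < v)%N.
  by move=> rg; rewrite ltn_divLR 1?mulnC -?gE //; lia.
(* Euclidean division by [u] splits [r] into [r %% u] and [u * (r %/ u)], and its uniqueness makes
   the sum direct. *)
exists [set (G * r)%N%:Z | r in `I_u], [set (G * (u * s))%N%:Z | s in `I_v]; split.
- by apply: (@card_ge2 _ _ 0 G%:Z); [exists 0%N; rewrite ?muln0 //=; lia|exists 1%N; rewrite ?muln1|lia].
- apply: (@card_ge2 _ _ 0 (G * u)%N%:Z); [|by exists 1%N; rewrite ?muln1|nia].
  by exists 0%N; rewrite ?muln0 //=; lia.
- apply/seteqP; split=> [_ /britishP[r rg ->]|_ [_ [r /= ru <-] [_ [s /= sv <-] <-]]].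
    exists (G * (r %% u))%N%:Z; first by exists (r %% u)%N => //=; rewrite ltn_mod; lia.
    exists (G * (u * (r %/ u)))%N%:Z; first by exists (r %/ u)%N; first exact: divu.
    by rewrite -PoszD -mulnDr addnC [(u * _)%N]mulnC -divn_eq.
  by apply/britishP; exists (r + u * s)%N; [rewrite gE; nia|rewrite mulnDr].
- move=> _ /britishP[r rg ->].
  exists ((G * (r %% u))%N%:Z, (G * (u * (r %/ u)))%N%:Z); split; first split=> /=.
  + by exists (r %% u)%N => //=; rewrite ltn_mod; lia.
  + by exists (r %/ u)%N; first exact: divu.
  + by rewrite -PoszD -mulnDr addnC [(u * _)%N]mulnC -divn_eq.
  move=> [_ _] [/= [s su <-] [t tv <-]]; rewrite -PoszD -mulnDr => -[/eqP].
  rewrite eqn_pmul2l // => /eqP ->.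
  have u0 : (0 < u)%N by exact: ltnW.
  by rewrite addnC [(u * t)%N]mulnC modnMDl divnMDl // modn_small // divn_small // addn0 [(t * u)%N]mulnC.
Qed.

(** * Additive systems as contractions *)

(** Iterating [descent_step] peels off one digit at a time; [i k] is the index whose set leaves
    digit [k] free. *)
Lemma weak_system_expansion (I : choiceType) (A : I -> set int) : weak_system A ->
  exists (i : nat -> I) (p : nat -> nat), (forall k, prime (p k)) /\
    forall j (n : nat), A j n%:Z <-> forall k, i k <> j -> digit p n k = 0%N.
Proof.
(* [W] bundles each family with its proof, so that [choice] yields a step function that can be
   iterated. *)
move=> wA; pose W := {B : I -> set int | weak_system B}.
have /choice[step stepP] (B : W) : exists ipB : I * nat * W,
    [/\ prime ipB.1.2,
        sval ipB.2 = (fun j => [set x | sval B j (ipB.1.2%:Z * x)]) &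
        forall j (n : nat), sval B j n%:Z <->
          (j <> ipB.1.1 -> (ipB.1.2 %| n)%N) /\ sval ipB.2 j (n %/ ipB.1.2)%N%:Z].
  have [i [p [p_pr wB BP]]] := descent_step (svalP B).
  by exists (i, p, exist _ _ wB); split=> // j n; rewrite BP /= PoszM.
pose B k := iter k (fun B => (step B).2) (exist _ _ wA : W).
pose i k := (step (B k)).1.1; pose p k := (step (B k)).1.2.
have p_pr k : prime (p k) by have [] := stepP (B k).
have p2 k := prime_gt1 (p_pr k).
have G0 k := leq_ltn_trans (leq0n k) (british_base_gt p2 k).
have BS k j (n : nat) : sval (B k) j n%:Z <->
    (i k <> j -> (p k %| n)%N) /\ sval (B k.+1) j (n %/ p k)%N%:Z.
  by have [_ _ ->] := stepP (B k); split=> -[dn ?]; split=> // /nesym.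
(* Invariant: the first [K] digits are settled, and [B K] governs the quotient formed by the
   remaining ones. *)
have AK K j (n : nat) : A j n%:Z <->
    (forall k, (k < K)%N -> i k <> j -> digit p n k = 0%N) /\
    sval (B K) j (n %/ british_base p K)%N%:Z.
  elim: K => [|K ->]; first by rewrite /british_base big_ord0 divn1; split=> [|[]].
  rewrite BS british_baseS divnMA; split=> [[dK [pK BK]]|[dK BK]].
    split=> // k; rewrite ltnS leq_eqVlt => /orP[/eqP -> /pK /eqP //|]; exact: dK.
  split=> [k kK|]; first by apply: dK; exact: ltnW.
  by split=> // ij; apply/eqP/dK.
exists i, p; split=> // j n; split=> [An k ij|dn].
  by have [/(_ k (leqnn _) ij)] := (AK k.+1 j n).1 An.
(* Depth [n] suffices: [n < british_base p n], so the remaining quotient is [0], which lies in every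
   set. *)
apply/(AK n); split=> [k _|]; first exact: dn.
rewrite divn_small ?british_base_gt //.
by have [_ B0 _] := svalP (B n); exact: B0.
Qed.

Lemma additive_system_contraction (I : choiceType) (A : I -> set int) :
  additive_system A ->
  exists p : nat -> nat, (forall k, prime (p k)) /\ contraction A (british p).
Proof.
move=> addA; have wA := additive_weak addA; have [_ Ai _] := addA.
have [i [p [p_pr AP]]] := weak_system_expansion wA; have p2 k := prime_gt1 (p_pr k).
exists p; split=> //; split; first exact: british_additive.
(* The parts are the fibres of [i]. The fibre over [j] is nonempty because a nonzero element of
   [A j] has a nonzero digit at some [k], which forces [i k = j]. *)
exists (fun j => [set k | i k = j]); split.
  split=> [|j j' _ _ [k [/= <- <-]] //|j _].
    by apply/seteqP; split=> // k _; exists (i k).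
  have [Apos _ A2] := Ai j; have [x Ax x0] := card_ge2_neq 0 A2.
  apply: contrapT => noi; apply: x0; have /gez0_abs xE := Apos _ Ax.
  rewrite -xE in Ax *; congr Posz; apply: (digit_eq0 p2) => k.
  by apply: (AP j _).1 => // ij; apply: noi; exists k.
move=> j; have [Apos _ _] := Ai j.
apply/seteqP; split=> x.
  move=> Ax; have /gez0_abs xE := Apos _ Ax; rewrite -xE in Ax *.
  by apply/(sumset_british p2) => k; exact: (AP j _).1.
move=> sx; have x0 : 0 <= x.
  case: sx => a [Ba _ ->]; apply: fsumr_ge0 => k jk.
  by have /britishP[r _ ->] := Ba k jk.
move: sx; rewrite -(gez0_abs x0) => /(sumset_british p2) dx.
exact/AP.
Qed.

(** * The correspondence with sequences of primes *)

Theorem theorem5 :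
  set_bij
    [set p : nat -> nat | forall i, prime (p i)]
    [set A : nat -> set int |
      british_number_system A /\ indecomposable_system A]
    british
  /\
  (forall (I : choiceType) (A : I -> set int),
     additive_system A ->
     indecomposable_system A \/
     exists (J : choiceType) (B : J -> set int),
       indecomposable_system B /\ contraction A B).
Proof.
have indec p : (forall i, prime (p i)) -> indecomposable_system (british p).
  move=> p_pr; split=> [|i]; last exact: british_indecomposable.
  by apply: british_additive => i; exact: prime_gt1.
split; last first.
  move=> I A /additive_system_contraction[p [p_pr cA]]; right.
  by exists nat, (british p); split=> //; exact: indec.
split=> [p /= p_pr|p q /set_mem /= p_pr /set_mem /= q_pr E|A [[g [g2 ->]] [_ gind]]].
- split; last exact: indec.
  by exists p; split=> // i; exact: prime_gt1.
- apply/funext => i; apply/card_eq_II.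
  have cp := card_british i (fun j => prime_gt1 (p_pr j)).
  have cq := card_british i (fun j => prime_gt1 (q_pr j)).
  by rewrite -(card_eql cp) -(card_eqr cq) E.
(* If [g i] is not prime, a proper divisor [d] and its cofactor [u] yield a decomposition of
   [british g i]. *)
exists g => //= i; apply: contrapT => /negP/primePn[|[d /andP[d1 dg] /dvdnP[u gE]]].
  by rewrite ltnNge g2.
by apply: (gind i); apply: (@british_decomposable _ _ d u) => //; nia.
Qed.
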